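(* Let $X$ be a locally compact, non-compact Hausdorff space, with one-point compactification $\alpha X = X \cup \{\star\}$. Suppose $\alpha X$ is radial at $\star$ and let $\phi X$ be a finite compactification of $X$. Then $\phi X$ is radial at every point of $\phi X \setminus X$.
   Context: A transfinite sequence is a net whose domain is (nonempty and) well-ordered. A space $Z$ is radial at $z$ if for every $A \subseteq Z$ with $z \in \overline{A}$ there is a transfinite sequence with range in $A$ converging to $z$. A compactification of $X$ is a compact Hausdorff space containing $X$ as a dense subspace; it is finite if its remainder (the complement of $X$ in it) is finite. $\star$ denotes the point at infinity of $\alpha X$. *)

(* Defs.v *)
From mathcomp Require Import all_boot.
From mathcomp Require Import all_classical topology.
From mathcomp Require wochoice.

Set Implicit Arguments.
Unset Strict Implicit.
Unset Printing Implicit Defensive.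

Local Open Scope classical_set_scope.

(* [wochoice.well_order R] (unique minimum for every nonempty subset) makes [R]
   the reflexive relation of a well-ordering, in particular a total order. *)
Definition transfinite_domain (I : eqType) (R : rel I) : Prop :=
  [set: I] !=set0 /\ wochoice.well_order R.

Definition tails (I : Type) (R : rel I) : set_system I :=
  filter_from [set: I] (fun i => [set j | R i j]).

Definition radial_at (Z : topologicalType) (z : Z) : Prop :=
  forall A : set Z, closure A z ->
    exists (I : eqType) (R : rel I) (x : I -> Z),
      [/\ transfinite_domain R, range x `<=` A & x @ tails R --> z].

Definition topological_embedding (X Y : topologicalType) (e : X -> Y) : Prop :=
  injective e /\ @open X = @open (initial_topology e).

(* The space [X] is identified with the subspace [range e] of [K]. *)
Definition compactification (X K : topologicalType) (e : X -> K) : Prop :=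
  [/\ compact [set: K], hausdorff_space K,
      topological_embedding e & dense (range e)].

Definition remainder (X K : Type) (e : X -> K) : set K := ~` range e.

Definition finite_compactification (X K : topologicalType) (e : X -> K) : Prop :=
  compactification e /\ finite_set (remainder e).

(* Main.v *)
(* A point [z] of the finite remainder has a closed neighbourhood [W] meeting
   the remainder only in [z]. For [U] open around [z], the closed set [W \ U] is
   then a compact subset of [X]; hence a sequence of [A `&` W] that converges to
   infinity in the one-point compactification is eventually in [U], that is, it
   converges to [z]. *)
Require Import Defs.
From mathcomp Require Import all_boot.
From mathcomp Require Import all_classical topology.

Local Open Scope classical_set_scope.

Lemma topological_embedding_continuous (X Y : topologicalType) (e : X -> Y) :
  topological_embedding e -> continuous e.
Proof.
by move=> [_ eo]; apply/continuousP => A oA; rewrite eo; exists A.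
Qed.

Lemma topological_embedding_nbhs (X Y : topologicalType) (e : X -> Y)
    (x : X) (B : set X) :
  topological_embedding e -> nbhs x B ->
  exists2 V : set Y, nbhs (e x) V & e @^-1` V `<=` B.
Proof.
move=> [_ eo]; rewrite nbhsE => -[U [oU Ux] UB].
move: oU; rewrite eo => -[V oV VU]; exists V; last by rewrite VU.
by apply: open_nbhs_nbhs; split=> //; move: Ux; rewrite -VU.
Qed.

(** A filter on the preimage is pushed forward along [e] and clusters at a point of [C]. That point
    lies in [range e], and neighbourhoods of its preimage are traces of neighbourhoods in [Y], so
    the cluster point pulls back. *)
Lemma topological_embedding_preimage_compact (X Y : topologicalType)
    (e : X -> Y) (C : set Y) :
  topological_embedding e -> C `<=` range e -> compact C ->
  compact (e @^-1` C).
Proof.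
move=> ee Ce cC F PF FC.
have [y [Cy clFy]] := cC (e @ F) (fmap_proper_filter e PF) FC.
have [x _ exy] := Ce y Cy; exists x; split; first by rewrite /= exy.
move=> P B FP /(topological_embedding_nbhs _ _ _ _ _ ee)[V eV VB].
have [_ [[p Pp <-] Vp]] : (e @` P) `&` V !=set0.
  apply: clFy; last by rewrite -exy.
  exact: (filterS (@preimage_image _ _ e P) FP).
by exists p; split=> //; exact: VB.
Qed.

(** A constant net on a one-point well-order suffices. *)
Lemma radial_at_mem (Z : topologicalType) (z : Z) (A : set Z) : A z ->
  exists (I : eqType) (R : rel I) (x : I -> Z),
    [/\ transfinite_domain R, range x `<=` A & x @ tails R --> z].
Proof.
move=> Az; exists unit, (fun _ _ => true), (fun=> z); split.
- split; first by exists tt.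
  by move=> P [[] Ptt]; exists tt; split=> [|[]//]; split=> // -[].
- by move=> _ [_ _ <-].
- by move=> V /nbhs_singleton Vz; exists tt.
Qed.

(** The other points of the remainder form a finite, hence closed, set; regularity of [K] shrinks
    its complement to a closed neighbourhood of [z]. *)
Lemma finite_compactification_isolated (X K : topologicalType) (e : X -> K)
    (z : K) :
  finite_compactification e ->
  exists W, [/\ nbhs z W, closed W & W `&` remainder e `<=` [set z]].
Proof.
move=> [[cK hK _ _] fr].
have clr : closed (remainder e `\ z).
  apply: accessible_finite_set_closed.1; first exact: hausdorff_accessible.
  exact: finite_setD.
have zO : nbhs z (~` (remainder e `\ z)).
  by apply: open_nbhs_nbhs; split; [exact: closed_openC | move=> -[_ []]].
have [B zB BO] := @compact_regular K z setT hK cK filterT _ zO.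
exists (closure B); split.
- exact: filterS (@subset_closure _ B) zB.
- exact: closed_closure.
- by move=> y [/BO By ry]; apply: contrapT => yz; apply: By.
Qed.

Theorem theorem3p2 (X : topologicalType)
    (hausdorffX : hausdorff_space X)
    (locally_compactX : locally_compact [set: X])
    (noncompactX : ~ compact [set: X])
    (radial_infty : radial_at (None : one_point_compactification X))
    (phiX : topologicalType) (e : X -> phiX)
    (finite_phiX : finite_compactification e) :
  forall z : phiX, remainder e z -> radial_at z.
Proof.
move=> z rz A clA.
(* Once [z] is outside [A], the set [A]&[W] misses the remainder, so pulling it back to [X] loses no
   point. *)
have [Az|nAz] := pselect (A z); first exact: radial_at_mem.
have [W [zW cW Wr]] := finite_compactification_isolated _ _ _ z finite_phiX.
have [[cK hK ee _] _] := finite_phiX.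
have ec := topological_embedding_continuous _ _ _ ee.
have clB : @closure (one_point_compactification X)
    (Some @` (e @^-1` (A `&` W))) None.
  move=> N [K [cptK _] KN].
  have ceK : closed (e @` K).
    apply: (compact_closed hK); apply: continuous_compact cptK.
    exact: continuous_subspaceT.
  have zeK : nbhs z (~` (e @` K)).
    apply: open_nbhs_nbhs; split; first exact: closed_openC.
    by case=> k _ ekz; apply: rz; exists k.
  have [y [Ay [Wy eKy]]] := clA _ (filterI zW zeK).
  have [[k _ eky]|ry] := pselect (range e y); last first.
    by exfalso; apply: nAz; have <- : y = z by apply: Wr.
  exists (Some k); split; first by exists k => //=; rewrite eky.
  by apply: KN; left; exists k => // Kk; apply: eKy; exists k.
have [I [R [x [RI xB xcvg]]]] := radial_infty _ clB.
(* The net [x] never takes the value [None], so it lifts to a net [y] in [X]. *)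
have /choice[y yP] : forall i, exists p, (A `&` W) (e p) /\ x i = Some p.
  by move=> i; have [p Bp <-] := xB (x i) (imageT x i); exists p.
exists I, R, (e \o y); split=> //.
  by move=> _ [i _ <-]; have [[]] := yP i.
move=> V; rewrite nbhsE => -[U [oU Uz] UV].
have cWU : closed (W `\` U) by apply: closedI => //; exact: open_closedC.
have WUe : W `\` U `<=` range e.
  move=> p [Wp nUp]; apply: contrapT => rp; apply: nUp.
  by have -> : p = z by apply: Wr.
(* The complement of a closed compact subset of [X], with [None] added, is a neighbourhood of
   infinity. *)
have [i _ iV] : tails R (x @^-1` (Some @` (~` (e @^-1` (W `\` U))) `|` [set None])).
  apply: xcvg; exists (e @^-1` (W `\` U)) => //; split.
    apply: topological_embedding_preimage_compact => //.
    exact: subclosed_compact cWU cK _.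
  by apply: closed_comp => // p _; exact: ec.
(* On this tail [e (y j)] lies in [W] but not in [W]\[U], hence in [U]. *)
exists i => // j /iV /=; have [[_ Wy] ->] := yP j.
case=> [[p nWU [py]]|//]; apply: UV; apply: contrapT => nU.
by apply: nWU; rewrite py.
Qed.
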